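(* Let $A_0\in\mathbb{R}^{n\times n}$ be Metzler, let $\bar h_1,\ldots,\bar h_N>0$ and let $A_i:[-\bar h_i,0]\to\mathbb{R}^{n\times n}$ be integrable kernels with $A_i(\theta)\ge0$ entrywise for all $\theta\in[-\bar h_i,0]$ (so the system below is positive). Consider $$\dot x(t)=A_0x(t)+\sum_{i=1}^N\int_{-\bar h_i}^0A_i(\theta)x(t+\theta)d\theta,$$ and define $\bar A_i:=\int_{-\bar h_i}^0A_i(\theta)d\theta$. The following statements are equivalent: (i) The system is asymptotically stable. (ii) $A_0+\sum_{i=1}^N\bar A_i$ is Hurwitz stable. (iii) There exists $v\in\mathbb{R}^n_{>0}$ such that $v^T\left(A_0+\sum_{i=1}^N\bar A_i\right)<0$. (iv) $A_0$ is Hurwitz stable and $-\left(\sum_{i=1}^N\bar A_i\right)A_0^{-1}$ is Schur stable. (v) There exist diagonal positive definite $P,Q_1,\ldots,Q_N\in\mathbb{R}^{n\times n}$ such that $$A_0^TP+PA_0+\sum_{i=1}^N\left(Q_i+P\bar A_iQ_i^{-1}\bar A_i^TP\right)\prec0.$$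
   Context: A Metzler matrix has nonnegative off-diagonal entries; vector inequalities are componentwise; $\prec0$ means negative definite; Schur stable means spectral radius less than 1. *)

(* Defs.v *)
From HB Require Import structures.
From mathcomp Require Import all_boot all_order all_algebra.
From mathcomp Require Import all_classical all_reals all_analysis.
From mathcomp Require Import complex.

Set Implicit Arguments.
Unset Strict Implicit.
Unset Printing Implicit Defensive.

Import Order.TTheory GRing.Theory Num.Theory.
Import numFieldNormedType.Exports.
Local Open Scope ring_scope.
Local Open Scope classical_set_scope.

Section Defs.
Variable R : realType.

Definition metzler n (A : 'M[R]_n) : Prop :=
  forall i j : 'I_n, i != j -> 0 <= A i j.

Definition cplx_mx n (A : 'M[R]_n) : 'M[R[i]]_n := map_mx (fun r => (r%:C)%C) A.

Definition hurwitz n (A : 'M[R]_n) : Prop :=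
  forall z : R[i], eigenvalue (cplx_mx A) z -> complex.Re z < 0.

Definition schur n (A : 'M[R]_n) : Prop :=
  forall z : R[i], eigenvalue (cplx_mx A) z -> `|z| < 1.

Definition neg_def n (M : 'M[R]_n) : Prop :=
  forall x : 'cV[R]_n, x != 0 -> (x^T *m M *m x) 0 0 < 0.

Definition diag_pos_def n (P : 'M[R]_n) : Prop :=
  (forall i j : 'I_n, i != j -> P i j = 0) /\ (forall i : 'I_n, 0 < P i i).

Definition vnorm n (x : 'cV[R]_n) : R := \big[Num.max/0]_(j < n) `|x j 0|.

Definition kernel_int n (h : R) (A : R -> 'M[R]_n) : 'M[R]_n :=
  \matrix_(j, k) Rintegral lebesgue_measure `[- h, 0] (fun t => A t j k).

Definition dd_rhs n N (A0 : 'M[R]_n) (hb : 'I_N -> R) (A : 'I_N -> R -> 'M[R]_n)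
  (x : R -> 'cV[R]_n) (t : R) : 'cV[R]_n :=
  A0 *m x t + \sum_(i < N)
     \col_j Rintegral lebesgue_measure `[- hb i, 0] (fun th => (A i th *m x (t + th)) j 0).

Definition hmax N (hb : 'I_N -> R) : R := \big[Num.max/0]_(i < N) hb i.

(* x is a solution: continuous on [-hmax, +oo) (its restriction to [-hmax,0] is the
   continuous initial function), and for t > 0 it is differentiable and satisfies
   the equation *)
Definition dd_solution n N (A0 : 'M[R]_n) (hb : 'I_N -> R) (A : 'I_N -> R -> 'M[R]_n)
  (x : R -> 'cV[R]_n) : Prop :=
  (forall j : 'I_n, {within [set s : R | - hmax hb <= s], continuous (fun s : R => x s j 0 : R)}) /\
  (forall t : R, 0 < t -> forall j : 'I_n,
     derivable (fun s => x s j 0) t 1 /\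
     (fun s => x s j 0)^`() t = dd_rhs A0 hb A x t j 0).

Definition dd_asym_stable n N (A0 : 'M[R]_n) (hb : 'I_N -> R) (A : 'I_N -> R -> 'M[R]_n) : Prop :=
  (forall eps : R, 0 < eps -> exists2 delta : R, 0 < delta &
     forall x, dd_solution A0 hb A x ->
       (forall s, - hmax hb <= s <= 0 -> vnorm (x s) < delta) ->
       forall t, 0 <= t -> vnorm (x t) < eps) /\
  (forall x, dd_solution A0 hb A x ->
     forall eps : R, 0 < eps -> exists T : R, forall t, T <= t -> vnorm (x t) < eps).

End Defs.

(* Main.v *)
(* All five conditions reduce to the existence of a positive vector [u] with [M u < 0], where [M] is
   the Metzler matrix [A0 + S] ([negative_on]).  Such a vector bounds the spectrum by a weighted
   Gershgorin estimate, makes [- M^-1] entrywise nonnegative, and yields diagonal solutions of the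
   Riccati inequality; it also makes [c u exp(- g t)] a barrier that solutions cannot cross.
   Conversely, if no such [u] exists, decreasing [t] to the first obstruction produces some
   [t >= 0] and [p != 0] with [F t *m p = t *: p], for any Lipschitz, entrywise nonincreasing family
   [F] of Metzler matrices with [F 0 = M].  For constant [F] this is a nonnegative real eigenvalue;
   for [F t = A0 + sum_i int A_i(s) exp(t s) ds] it is the solution [exp(t s) p] of the delay system,
   which does not tend to [0]. *)

Require Import Defs.
From HB Require Import structures.
From mathcomp Require Import all_boot all_order all_algebra.
From mathcomp Require Import all_classical all_reals all_analysis.
From mathcomp Require Import complex measurable_realfun.
From mathcomp Require Import ring lra.

Import Order.TTheory GRing.Theory Num.Theory.
Import numFieldNormedType.Exports.
Local Open Scope ring_scope.
Local Open Scope classical_set_scope.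

Set Implicit Arguments.
Unset Strict Implicit.

(** * Metzler matrices with a positive vector of negative image *)

(** For Metzler [M] such a [u] certifies Hurwitz stability. Statement (iii) is this predicate for
    the transpose of [A0 + S]. *)
Definition negative_on {R : realType} {n : nat} (M : 'M[R]_n) (u : 'cV[R]_n) : Prop :=
  (forall i, 0 < u i 0) /\ (forall i, (M *m u) i 0 < 0).

Lemma metzler_tr (R : realType) (n : nat) (M : 'M[R]_n) : metzler M -> metzler M^T.
Proof. by move=> MM i j ij; rewrite mxE; apply: MM; rewrite eq_sym. Qed.

(** Where [x] touches zero, the diagonal entry drops out and only nonnegative terms remain. This
    touching argument recurs in the comparison proofs. *)
Lemma metzler_row_ge0 (R : realType) (n : nat) (M : 'M[R]_n) (x : 'cV[R]_n) (i : 'I_n) :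
  metzler M -> (forall j, 0 <= x j 0) -> x i 0 = 0 -> 0 <= (M *m x) i 0.
Proof.
move=> MM x0 xi; rewrite mxE; apply: sumr_ge0 => j _.
have [->|ji] := eqVneq j i; first by rewrite xi mulr0.
by rewrite mulr_ge0 ?MM// eq_sym.
Qed.

(** Comparison principle. Let [c] be the minimum of [x i / u i], attained at [i]. If [c < 0], then
    [x - c *: u] is nonnegative and vanishes at [i], so row [i] of its image is nonnegative; but
    [M x <= 0] and [M u < 0] make that row negative. *)
Lemma negative_on_monotone (R : realType) (n : nat) (M : 'M[R]_n) (u x : 'cV[R]_n) :
  metzler M -> negative_on M u -> (forall i, (M *m x) i 0 <= 0) -> forall i, 0 <= x i 0.
Proof.
move=> MM [u0 Mu] Mx i0; rewrite leNgt; apply/negP => xi0.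
case: (@arg_minP _ _ _ i0 xpredT (fun i => x i 0 / u i 0) isT) => i _ mini.
set c := x i 0 / u i 0 in mini *.
have c0 : c < 0.
  by rewrite (le_lt_trans (mini i0 isT))// pmulr_llt0// invr_gt0.
have : 0 <= (M *m (x - c *: u)) i 0.
  apply: metzler_row_ge0 => // [j|].
    by rewrite !mxE subr_ge0 -ler_pdivlMr// mini.
  by rewrite !mxE /c divfK ?subrr// gt_eqF.
rewrite mulmxBr -scalemxAr mxE [X in _ + X]mxE [X in _ - X]mxE.
have := Mx i; have := Mu i.
set a := (M *m u) i 0; set b := (M *m x) i 0 => a0 b0.
have : 0 < c * a by rewrite nmulr_rgt0.
lra.
Qed.

Lemma metzler_pos_of_ge0 (R : realType) (n : nat) (M : 'M[R]_n) (u : 'cV[R]_n) :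
  metzler M -> (forall i, 0 <= u i 0) -> (forall i, (M *m u) i 0 < 0) -> negative_on M u.
Proof.
move=> MM u0 Mu; split=> // i; rewrite lt_def u0 andbT; apply/eqP => ui.
by have := metzler_row_ge0 MM u0 ui; rewrite leNgt Mu.
Qed.

(** Monotonicity applied to a kernel vector and to its opposite forces it to vanish. *)
Lemma negative_on_unitmx (R : realType) (n : nat) (M : 'M[R]_n) (u : 'cV[R]_n) :
  metzler M -> negative_on M u -> M \in unitmx.
Proof.
move=> MM Mu; rewrite -unitmx_tr -row_free_unit -kermx_eq0; apply/eqP.
apply/row_matrixP => i; rewrite row0.
have := congr1 (row i) (mulmx_ker M^T).
rewrite row_mul row0; move: (row i _) => r /(congr1 trmx).
rewrite trmx_mul trmxK trmx0 => Mr.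
have r0 := negative_on_monotone MM Mu (x := r^T).
have r1 := negative_on_monotone MM Mu (x := - r^T).
apply/rowP => j; rewrite [RHS]mxE; apply/eqP; rewrite eq_le.
have := r0 _ j; rewrite mxE => -> //; last by move=> k; rewrite Mr mxE.
have := r1 _ j; rewrite !mxE oppr_ge0 => -> // k; by rewrite mulmxN Mr !mxE oppr0.
Qed.

(** [M] sends each column of [- invmx M] to minus a basis vector, so monotonicity applies to that
    column. *)
Lemma negative_on_inv_le0 (R : realType) (n : nat) (M : 'M[R]_n) (u : 'cV[R]_n) :
  metzler M -> negative_on M u -> forall i j, invmx M i j <= 0.
Proof.
move=> MM Mu i j; have uM := negative_on_unitmx MM Mu.
have := negative_on_monotone MM Mu (x := - col j (invmx M)) _ i.
rewrite !mxE oppr_ge0; apply => k.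
by rewrite mulmxN colE mulKVmx// !mxE oppr_le0 ler0n.
Qed.

(** The witness solves [M^T v = -1]; it is nonnegative because [- invmx M] is. *)
Lemma negative_on_tr (R : realType) (n : nat) (M : 'M[R]_n) (u : 'cV[R]_n) :
  metzler M -> negative_on M u -> exists v, negative_on M^T v.
Proof.
move=> MM Mu; have uM := negative_on_unitmx MM Mu.
exists (- ((invmx M)^T *m const_mx 1)).
apply: metzler_pos_of_ge0 => [|i|i]; first exact: metzler_tr.
  rewrite !mxE oppr_ge0; apply: sumr_le0 => j _.
  by rewrite !mxE mulr1 (negative_on_inv_le0 MM Mu).
by rewrite mulmxN trmx_inv mulKVmx ?unitmx_tr// !mxE oppr_lt0.
Qed.

Lemma singular_ker (R : realType) (n : nat) (M : 'M[R]_n) :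
  M \notin unitmx -> exists2 p : 'cV[R]_n, p != 0 & M *m p = 0.
Proof.
rewrite -unitmx_tr -row_free_unit -kermx_eq0 => /rowV0Pn[v /sub_kermxP vM v0].
exists v^T; first by rewrite trmx_eq0.
by rewrite -[M]trmxK -trmx_mul vM trmx0.
Qed.

Lemma finite_lower_bound (R : realType) (n : nat) (f : 'I_n -> R) :
  (forall i, 0 < f i) -> exists2 m, 0 < m & forall i, m <= f i.
Proof.
move=> f0; exists (\big[Num.min/1]_(i < n) f i); last by move=> i; exact: bigmin_le_cond.
by apply: lt_bigmin.
Qed.

Lemma ler_sum_norm (R : realType) (n : nat) (f : 'I_n -> R) (i : 'I_n) :
  f i <= \sum_(j < n) `|f j|.
Proof. by rewrite (le_trans (ler_norm _))// (bigD1 i)//= lerDl sumr_ge0. Qed.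

(** * One-parameter families of Metzler matrices *)

Section MetzlerFamily.
Variables (R : realType) (n : nat) (F : R -> 'M[R]_n) (L : R).
Hypothesis F_metzler : forall t, 0 <= t -> metzler (F t).
Hypothesis F_le : forall s t i j, 0 <= s -> s <= t -> F t i j <= F s i j.
Hypothesis F_lip : forall s t i j, 0 <= s -> 0 <= t -> `|F s i j - F t i j| <= L * `|s - t|.

Let B t := F t - t%:M.

Let BE t (u : 'cV[R]_n) i : (B t *m u) i 0 = (F t *m u) i 0 - t * u i 0.
Proof. by rewrite mulmxBl mul_scalar_mx !mxE. Qed.

Let B_metzler t : 0 <= t -> metzler (B t).
Proof. by move=> t0 i j ij; rewrite !mxE (negbTE ij) mulr0n subr0 F_metzler. Qed.

Let B_lip (u : 'cV[R]_n) : exists2 C, 0 < C & forall s t i, 0 <= s -> 0 <= t ->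
  (B s *m u) i 0 <= (B t *m u) i 0 + C * `|s - t|.
Proof.
pose U := \sum_(j < n) `|u j 0|.
have U0 : 0 <= U by apply: sumr_ge0.
(* [|L|] times the l1 norm [U] bounds the variation of [F], one more [U] that of the scalar shift;
   the leading 1 keeps the constant positive, as it is later a divisor. *)
exists (1 + (`|L| + 1) * U) => [|s t i s0 t0].
  by rewrite ltr_pwDl// mulr_ge0// addr_ge0.
rewrite !BE -lerBlDl.
have -> : (F s *m u) i 0 - s * u i 0 - ((F t *m u) i 0 - t * u i 0)
  = \sum_j (F s i j - F t i j) * u j 0 - (s - t) * u i 0.
  rewrite !mxE; under [in RHS]eq_bigr do rewrite mulrBl.
  by rewrite sumrB; ring.
have h1 : \sum_j (F s i j - F t i j) * u j 0 <= `|L| * `|s - t| * U.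
  rewrite mulr_sumr; apply: ler_sum => j _.
  rewrite (le_trans (ler_norm _))// normrM ler_wpM2r//.
  by rewrite (le_trans (F_lip _ _ s0 t0))// ler_wpM2r// ler_norm.
have h2 : - ((s - t) * u i 0) <= `|s - t| * U.
  rewrite (le_trans (ler_norm _))// normrN normrM ler_wpM2l//.
  by rewrite /U (bigD1 i)//= lerDl sumr_ge0.
have := lerD h1 h2; have : 0 <= `|s - t| by [].
by set a := `|s - t|; set b := `|L|; set c := \sum_j _; nra.
Qed.

Let B_open (u : 'cV[R]_n) t : 0 <= t -> (forall i, (B t *m u) i 0 < 0) ->
  exists2 d, 0 < d & forall s, 0 <= s -> `|s - t| <= d -> forall i, (B s *m u) i 0 < 0.
Proof.
move=> t0 Bu.
have [|m m0 mB] := @finite_lower_bound R n (fun i => - (B t *m u) i 0).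
  by move=> i; rewrite oppr_gt0.
have [C C0 BC] := B_lip u.
exists (m / (2 * C)) => [|s s0 st i]; first by rewrite divr_gt0// mulr_gt0.
apply: (le_lt_trans (BC s t i s0 t0)).
have : C * `|s - t| <= m / 2.
  rewrite (le_trans (ler_wpM2l (ltW C0) st))// le_eqVlt; apply/orP; left.
  by apply/eqP; field; rewrite gt_eqF.
by have := mB i; lra.
Qed.

Let T := [set t | 0 <= t /\ exists u, negative_on (B t) u].

Let T_up s t : T s -> s <= t -> T t.
Proof.
move=> [s0 [u [u0 Bu]]] st; split; first exact: le_trans st.
exists u; split=> // i; apply: le_lt_trans (Bu i); rewrite !BE lerB//.
  by rewrite !mxE; apply: ler_sum => j _; rewrite ler_wpM2r ?F_le// ltW.
by rewrite ler_wpM2r// ltW.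
Qed.

Let T_nonempty : T !=set0.
Proof.
(* [K] bounds every row sum of [F 0], hence of [F t] by monotonicity, so after subtracting [K + 1]
   the all-ones vector has negative image. *)
pose K := \sum_(i < n) \sum_(j < n) `|F 0 i j|.
have K0 : 0 <= K by apply: sumr_ge0 => i _; apply: sumr_ge0.
exists (K + 1); split; first by rewrite addr_ge0.
exists (const_mx 1); split=> i; first by rewrite mxE.
rewrite BE !mxE mulr1 subr_lt0 (@le_lt_trans _ _ K) ?ltrDl//.
rewrite (@le_trans _ _ (\sum_j `|F 0 i j|))//.
  apply: ler_sum => j _; rewrite mxE mulr1 (le_trans _ (ler_norm _))//.
  by rewrite F_le// addr_ge0.
by rewrite /K [leRHS](bigD1 i)//= lerDl; do 2!(apply: sumr_ge0 => ? _).
Qed.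

(* The infimum [t0] of the [t] such that [F t - t] admits a positive vector with negative image is
   never attained at [t0 > 0]; if [F t0 - t0] were invertible, the solution [u] of
   [(F t0 - t0) u = -1] would by monotonicity at nearby [t > t0] be such a vector at [t0]. *)
Lemma metzler_family_dichotomy :
  (exists u, negative_on (F 0) u) \/
  (exists t (p : 'cV[R]_n), [/\ 0 <= t, p != 0 & F t *m p = t *: p]).
Proof.
have T0 : lbound T 0 by move=> t [].
have hT : has_inf T by split; [exact: T_nonempty | exists 0].
set t0 := inf T.
have t00 : 0 <= t0 by apply: lb_le_inf => //; exact: T_nonempty.
have [uB|sB] := boolP (B t0 \in unitmx); last first.
  right; have [p p0 Bp] := singular_ker sB; exists t0, p; split=> //.
  by apply/eqP; rewrite -subr_eq0 -mul_scalar_mx -mulmxBl; exact/eqP.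
have [u Bu] : exists u, negative_on (B t0) u.
  pose u := invmx (B t0) *m (const_mx (-1)) : 'cV[R]_n.
  have Bu i : (B t0 *m u) i 0 < 0 by rewrite mulKVmx// mxE ltrN10.
  exists u; apply: metzler_pos_of_ge0 => //; first exact: B_metzler.
  have [d d0 Bd] := B_open t00 Bu.
  have [t Tt tt0] := inf_adherent d0 hT.
  have t0t : t0 <= t by apply: ge_inf Tt; exists 0.
  have [tge0 [w Bw]] := Tt.
  apply: (negative_on_monotone (B_metzler tge0) Bw) => i; apply/ltW/Bd => //.
  by rewrite ger0_norm ?subr_ge0// lerBlDl ltW.
left; exists u; suff <- : B t0 = F 0 by [].
have [->|t0n] := eqVneq t0 0; first by rewrite /B raddf0 subr0.
have [d d0 Bd] := B_open t00 Bu.2.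
have t0p : 0 < t0 by rewrite lt_def t0n.
pose s := Num.max 0 (t0 - d).
have st0 : s < t0 by rewrite gt_max t0p ltrBlDr ltrDl.
have s0 : 0 <= s by rewrite le_max lexx.
have : T s.
  split=> //; exists u; split; first exact: Bu.1.
  have : t0 - d <= s by rewrite le_max lexx orbT.
  by move=> st; apply: Bd => //; rewrite ler0_norm ?subr_le0 ?(ltW st0)//; lra.
by move=> /(ge_inf (ex_intro _ 0 T0)); rewrite leNgt st0.
Qed.

End MetzlerFamily.

Lemma metzler_dichotomy (R : realType) (n : nat) (M : 'M[R]_n) : metzler M ->
  (exists u, negative_on M u) \/ (exists t (p : 'cV[R]_n), [/\ 0 <= t, p != 0 & M *m p = t *: p]).
Proof.
move=> MM; apply: (@metzler_family_dichotomy _ _ (fun=> M) 0) => //.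
by move=> s t i j _ _; rewrite subrr normr0 mul0r.
Qed.

(** * Spectra *)

(** [eigenvalue] refers to row eigenvectors, so the discs come from the columns of [M]. The index
    [j] maximizes the modulus of [x j] relative to [v j], and the [j]-th coordinate of the
    eigenvector equation gives the bound. *)
Lemma weighted_gershgorin (R : realType) (n : nat) (M : 'M[R]_n) (v : 'cV[R]_n) (z : R[i]) :
  (forall i, 0 < v i 0) -> eigenvalue (cplx_mx M) z ->
  exists j, `|z - ((M j j)%:C)%C| <= (((\sum_(i | i != j) v i 0 * `|M i j|) / v j 0)%:C)%C.
Proof.
move=> v0 /eigenvalueP[x xM /rV0Pn[i0 xi0]].
have normE (w : R[i]) : ((complex.Re `|w|)%:C)%C = `|w| by rewrite RRe_real ?normr_real.
(* The moduli are turned into reals before maximizing, since the order on [R[i]] is only partial. *)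
pose r i := complex.Re `|x 0 i|.
case: (@arg_maxP _ _ _ i0 xpredT (fun i => r i / v i 0) isT) => j _ maxj.
exists j; set q := r j / v j 0 in maxj.
have q0 : 0 < q.
  apply: lt_le_trans (maxj i0 isT); rewrite divr_gt0//.
  by rewrite -ltcR normE normr_gt0.
have rq i : `|x 0 i| <= ((q * v i 0)%:C)%C.
  by rewrite -normE lecR -ler_pdivrMr//; exact: maxj.
have xjE : `|x 0 j| = ((q * v j 0)%:C)%C.
  by rewrite /q divfK ?normE// gt_eqF.
have eqj : (z - ((M j j)%:C)%C) * x 0 j = \sum_(i | i != j) x 0 i * ((M i j)%:C)%C.
  have /rowP/(_ j) := xM; rewrite !mxE (bigD1 j)//= !mxE.
  under eq_bigr do rewrite mxE.
  by rewrite mulrBl => <-; rewrite [X in _ - X]mulrC addrAC subrr add0r.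
have qv : 0 < q * v j 0 by rewrite mulr_gt0.
rewrite -(ler_pM2r (x := ((q * v j 0)%:C)%C)); last by rewrite (ltcR 0).
rewrite -{1}xjE -normrM eqj.
have -> : (\sum_(i | i != j) v i 0 * `|M i j|) / v j 0 = 
   (\sum_(i | i != j) q * v i 0 * `|M i j|) / (q * v j 0).
  under [in RHS]eq_bigr do rewrite -mulrA.
  by rewrite -mulr_sumr -mulf_div divff ?mul1r// gt_eqF.
rewrite -rmorphM divfK ?gt_eqF// rmorph_sum/=.
rewrite (le_trans (ler_norm_sum _ _ _))//; apply: ler_sum => i _.
by rewrite normrM rmorphM/= ler_pM// normc_def/= expr0n addr0 sqrtr_sqr.
Qed.

Lemma eigenvalue_ker_tr (R : realType) (n : nat) (M : 'M[R]_n) (p : 'cV[R]_n) (t : R) :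
  p != 0 -> M^T *m p = t *: p -> eigenvalue (cplx_mx M) (t%:C)%C.
Proof.
move=> p0 Mp; apply/eigenvalueP; exists (map_mx (real_complex R) p^T).
  rewrite -map_mxM -map_mxZ; congr map_mx.
  by rewrite -[M]trmxK -trmx_mul Mp linearZ.
by rewrite map_mx_eq0 trmx_eq0.
Qed.

(** Forward, the other alternative of the dichotomy for [M^T] is a nonnegative real eigenvalue.
    Backward, [M^T v < 0] says that each weighted Gershgorin disc has centre plus radius negative,
    so it lies in the open left half-plane. *)
Lemma hurwitz_negative_on (R : realType) (n : nat) (M : 'M[R]_n) : metzler M ->
  hurwitz M <-> exists v, negative_on M^T v.
Proof.
move=> MM; split=> [hM|[v [v0 Mv]] z /(weighted_gershgorin v0)[j]].
  have [//|[t [p [t0 p0 Mp]]]] := metzler_dichotomy (metzler_tr MM).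
  by have /hM := eigenvalue_ker_tr p0 Mp; rewrite /= ltNge t0.
have := Mv j; rewrite mxE (bigD1 j)//= !mxE.
have -> : \sum_(i | i != j) M^T j i * v i 0 = \sum_(i | i != j) v i 0 * `|M i j|.
  by apply: eq_bigr => i ij; rewrite mxE mulrC ger0_norm// MM.
set s := \sum_(i | _) _ => Ms zM.
have sM : s / v j 0 < - M j j by rewrite ltr_pdivrMr//; lra.
have := le_trans (normc_ge_Re _) zM; rewrite lecR raddfB/= => h.
by have := le_trans (ler_norm _) h; lra.
Qed.

Lemma negative_on_trE (R : realType) (n : nat) (M : 'M[R]_n) : metzler M ->
  (exists u, negative_on M u) <-> (exists v, negative_on M^T v).
Proof.
move=> MM; split=> -[u Mu]; first exact: negative_on_tr Mu.
by rewrite -[M]trmxK; apply: negative_on_tr Mu; exact: metzler_tr.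
Qed.

(** [B - 1%:M] is Metzler, and an eigenvalue [t >= 0] of it is an eigenvalue [1 + t] of [B].
    Conversely the discs have centre [B j j >= 0] and radius below [1 - B j j], so they lie in the
    open unit disc. *)
Lemma nonneg_schur (R : realType) (n : nat) (B : 'M[R]_n) : (forall i j, 0 <= B i j) ->
  schur B <-> exists v, negative_on (B - 1%:M)^T v.
Proof.
move=> B0; split=> [sB|[v [v0 Bv]] z /(weighted_gershgorin v0)[j]].
  have BM : metzler (B - 1%:M).
    by move=> i j ij; rewrite !mxE (negbTE ij) subr0.
  have [//|[t [p [t0 p0 Bp]]]] := metzler_dichotomy (metzler_tr BM).
  have /sB : eigenvalue (cplx_mx B) ((1 + t)%:C)%C.
    apply: eigenvalue_ker_tr p0 _.
    move: Bp; rewrite linearB/= trmx1 mulmxBl mul1mx => /eqP.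
    by rewrite subr_eq addrC scalerDl scale1r => /eqP.
  rewrite ger0_norm ?(ltcR _ 1) ?(lecR 0) ?addr_ge0//.
  by rewrite ltNge lerDl t0.
have := Bv j; rewrite linearB/= trmx1 mulmxBl mul1mx 2!mxE (bigD1 j)//= !mxE.
have -> : \sum_(i | i != j) B^T j i * v i 0 = \sum_(i | i != j) v i 0 * `|B i j|.
  by apply: eq_bigr => i ij; rewrite mxE mulrC ger0_norm.
set s := \sum_(i | _) _ => Bs zB.
rewrite -[z](subrK ((B j j)%:C)%C) (le_lt_trans (ler_normD _ _))//.
rewrite (@ger0_norm _ ((B j j)%:C)%C) ?ler0c//.
apply: (le_lt_trans (lerD zB (lexx _))); rewrite -rmorphD (ltcR _ 1).
have : s / v j 0 < 1 - B j j by rewrite ltr_pdivrMr//; lra.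
by lra.
Qed.

Lemma hurwitz_negative_on_col (R : realType) (n : nat) (M : 'M[R]_n) : metzler M ->
  hurwitz M <-> exists u, negative_on M u.
Proof.
by move=> MM; apply: iff_trans (hurwitz_negative_on MM) (iff_sym (negative_on_trE MM)).
Qed.

(** * The splitting of [A0 + S] and Schur stability *)

Lemma mulmx_ge0 (R : realType) (m n p : nat) (A : 'M[R]_(m, n)) (B : 'M[R]_(n, p)) :
  (forall i j, 0 <= A i j) -> (forall i j, 0 <= B i j) -> forall i j, 0 <= (A *m B) i j.
Proof. by move=> A0 B0 i j; rewrite mxE; apply: sumr_ge0 => k _; rewrite mulr_ge0. Qed.

Lemma metzlerD (R : realType) (n : nat) (A0 S : 'M[R]_n) :
  metzler A0 -> (forall i j, 0 <= S i j) -> metzler (A0 + S).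
Proof. by move=> AM S0 i j ij; rewrite mxE addr_ge0 ?AM. Qed.

(** With [B = - S A0^-1] and [y = - A0 u] one has [(B - 1) y = (A0 + S) u], so a negative image on
    one side is a negative image on the other. Moreover [A0 u <= (A0 + S) u < 0] yields the
    stability of [A0] and the positivity of [y]. *)
Lemma hurwitz_schur_splitting (R : realType) (n : nat) (A0 S : 'M[R]_n) :
  metzler A0 -> (forall i j, 0 <= S i j) ->
  hurwitz (A0 + S) <-> hurwitz A0 /\ schur (- (S *m invmx A0)).
Proof.
move=> AM S0; have MM := metzlerD AM S0.
have B0 u : negative_on A0 u -> forall i j, 0 <= (- (S *m invmx A0)) i j.
  move=> Au i j; rewrite -mulmxN; apply: mulmx_ge0 => // k l.
  by rewrite mxE oppr_ge0 (negative_on_inv_le0 AM Au).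
have BM u : negative_on A0 u -> metzler (- (S *m invmx A0) - 1%:M).
  by move=> Au i j ij; have := B0 _ Au i j; rewrite !mxE (negbTE ij) subr0.
rewrite !hurwitz_negative_on_col//; split=> [[u [u0 Mu]]|[[w Aw]]].
  have Au : negative_on A0 u.
    split=> // i; apply: le_lt_trans (Mu i); rewrite mulmxDl [leRHS]mxE lerDl.
    by apply: mulmx_ge0 => // j k; rewrite ord1 ltW.
  split; first by exists u.
  apply/(nonneg_schur (B0 _ Au))/(negative_on_trE (BM _ Au)).
  exists (- (A0 *m u)); split=> i; first by rewrite mxE oppr_gt0 Au.2.
  have := Mu i; rewrite mulmxBl mul1mx opprK mulNmx mulmxN opprK -mulmxA.
  by rewrite mulKmx ?(negative_on_unitmx AM Au)// -mulmxDl addrC.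
move=> /(nonneg_schur (B0 _ Aw))/(negative_on_trE (BM _ Aw))[y [y0 By]].
(* Inverse substitution: [- A0^-1] is entrywise nonnegative, so this vector is nonnegative, and
   strict positivity follows from its negative image. *)
exists (- (invmx A0 *m y)); apply: metzler_pos_of_ge0 => // i.
  rewrite -mulNmx; apply: mulmx_ge0 => [k l|k l]; last by rewrite ord1 ltW.
  by rewrite mxE oppr_ge0 (negative_on_inv_le0 AM Aw).
have := By i; rewrite mulmxBl mul1mx mulmxN mulmxDl mulKVmx ?(negative_on_unitmx AM Aw)//.
by rewrite mulmxA mulNmx opprD addrC.
Qed.

(** * The diagonal Riccati inequality *)

Lemma diag_pos_defE (R : realType) (n : nat) (Q : 'M[R]_n) :
  diag_pos_def Q -> Q = diag_mx (\row_j Q j j).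
Proof.
move=> [Q0 _]; apply/matrixP => i j; rewrite !mxE; have [->|ij] := eqVneq i j.
  by rewrite mulr1n.
by rewrite mulr0n Q0.
Qed.

Lemma diag_pos_def_diag (R : realType) (n : nat) (d : 'I_n -> R) :
  (forall j, 0 < d j) -> diag_pos_def (diag_mx (\row_j d j)).
Proof.
by move=> d0; split=> [i j ij|i]; rewrite !mxE ?(negbTE ij)// eqxx mulr1n.
Qed.

Lemma invmx_diag_pos (R : realType) (n : nat) (d : 'I_n -> R) :
  (forall j, 0 < d j) -> invmx (diag_mx (\row_j d j)) = diag_mx (\row_j (d j)^-1).
Proof.
move=> d0; set D := diag_mx _; set E := diag_mx _.
have DE : D *m E = 1%:M.
  rewrite mulmx_diag; apply/matrixP => i j; rewrite !mxE divff//.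
  by rewrite gt_eqF.
by have [uD _] := mulmx1_unit DE; rewrite -[E](mulKmx uD) DE mulmx1.
Qed.

(** Coordinatewise, the difference of the two sides is the completed square [(q x - y)^2 / q]. *)
Lemma diag_young (R : realType) (n : nat) (Q : 'M[R]_n) (x y : 'cV[R]_n) : diag_pos_def Q ->
  2 * (x^T *m y) 0 0 <= (x^T *m Q *m x) 0 0 + (y^T *m invmx Q *m y) 0 0.
Proof.
move=> /[dup] Qd /diag_pos_defE ->; rewrite invmx_diag_pos ?Qd.2//; last exact: Qd.2.
rewrite !mul_mx_diag !mxE mulr_sumr -big_split/=; apply: ler_sum => j _.
rewrite !mxE; have q0 := Qd.2 j; set q := Q j j in q0 *.
rewrite -subr_ge0.
have -> : x j 0 * q * x j 0 + y j 0 * q^-1 * y j 0 - 2 * (x j 0 * y j 0) =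
  (q * x j 0 - y j 0) ^+ 2 / q by field; rewrite gt_eqF.
by rewrite divr_ge0 ?sqr_ge0 ?ltW.
Qed.

(* After the substitution [x = diag(u) y], each off-diagonal term is bounded by AM-GM and the
   row sums of [H diag(u)] take over. *)
Lemma metzler_sym_neg_def (R : realType) (n : nat) (H : 'M[R]_n) (u : 'cV[R]_n) :
  metzler H -> H^T = H -> negative_on H u -> neg_def H.
Proof.
move=> HM HT [u0 Hu] x /cV0Pn[i0 xi0].
pose y i := x i 0 / u i 0.
have xE i : x i 0 = u i 0 * y i by rewrite mulrC divfK// gt_eqF.
pose Y i j := H i j * u i 0 * u j 0.
have YC i j : Y i j = Y j i by rewrite /Y -{1}HT mxE; ring.
have -> : (x^T *m H *m x) 0 0 = \sum_i \sum_j Y i j * y i * y j.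
  rewrite -mulmxA mxE; apply: eq_bigr => i _; rewrite !mxE mulr_sumr.
  by apply: eq_bigr => j _; rewrite !xE /Y; ring.
apply: (@le_lt_trans _ _ (\sum_i y i ^+ 2 * u i 0 * (H *m u) i 0)); last first.
  rewrite (bigD1 i0)//= -[ltRHS]addr0 ltr_leD//.
    by rewrite pmulr_rlt0// mulr_gt0// exprn_even_gt0//= mulf_neq0// invr_eq0 gt_eqF.
  apply: sumr_le0 => i _; apply: mulr_ge0_le0; last exact: ltW.
  by apply: mulr_ge0; [exact: sqr_ge0 | exact: ltW].
have -> : \sum_i y i ^+ 2 * u i 0 * (H *m u) i 0 =
    \sum_i \sum_j Y i j * ((y i ^+ 2 + y j ^+ 2) / 2).
  transitivity (\sum_i \sum_j Y i j * y i ^+ 2).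
    apply: eq_bigr => i _; rewrite !mxE mulr_sumr.
    by apply: eq_bigr => j _; rewrite /Y; ring.
  have E : \sum_i \sum_j Y i j * y i ^+ 2 = \sum_i \sum_j Y i j * y j ^+ 2.
    rewrite exchange_big; apply: eq_bigr => i _; apply: eq_bigr => j _.
    by rewrite YC.
  transitivity ((\sum_i \sum_j Y i j * y i ^+ 2 + \sum_i \sum_j Y i j * y j ^+ 2) / 2).
    by rewrite -E; field.
  rewrite -big_split/= mulr_suml; apply: eq_bigr => i _.
  rewrite -big_split/= mulr_suml; apply: eq_bigr => j _.
  by field.
(* The diagonal terms coincide, which matters because [Y i i] has no known sign; off the diagonal
   [Y i j >= 0] permits AM-GM. *)
apply: ler_sum => i _; apply: ler_sum => j _; have [->|ij] := eqVneq i j.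
  by rewrite -mulrA le_eqVlt; apply/orP; left; apply/eqP; field.
have Y0 : 0 <= Y i j by rewrite !mulr_ge0 ?HM// ltW.
rewrite -mulrA ler_wpM2l//; have := sqr_ge0 (y i - y j); rewrite sqrrB.
by rewrite ler_pdivlMr//; lra.
Qed.

Section DiagonalRiccati.
Variables (R : realType) (n N : nat) (A0 : 'M[R]_n) (Ab : 'I_N -> 'M[R]_n).
Hypothesis A0_metzler : metzler A0.
Hypothesis Ab_ge0 : forall i j k, 0 <= Ab i j k.

Let M := A0 + \sum_(i < N) Ab i.

Let M_metzler : metzler M.
Proof.
by apply: metzlerD => // j k; rewrite summxE; apply: sumr_ge0 => i _.
Qed.

Let Ric P Q := A0^T *m P + P *m A0 +
  \sum_(i < N) (Q i + P *m Ab i *m invmx (Q i) *m (Ab i)^T *m P).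

Let Ric_tr P Q : diag_pos_def P -> (forall i, diag_pos_def (Q i)) -> (Ric P Q)^T = Ric P Q.
Proof.
have trD (D : 'M[R]_n) : diag_pos_def D -> D^T = D.
  by move=> /diag_pos_defE ->; rewrite tr_diag_mx.
move=> Pd Qd; rewrite /Ric !linearD/= linear_sum/= !trmx_mul trmxK (trD _ Pd).
rewrite [A0^T *m P + _]addrC; congr (_ + _); apply: eq_bigr => i _.
by rewrite linearD/= !trmx_mul trmxK trmx_inv (trD _ Pd) (trD _ (Qd i)) !mulmxA.
Qed.

(** Otherwise [M p = t p] with [t >= 0] and [p != 0]. Young's inequality with [y i = Ab_i^T P p]
    bounds the Riccati form at [p] below by [2 p^T P M p = 2 t p^T P p >= 0], against negative
    definiteness. *)
Lemma riccati_hurwitz P Q : diag_pos_def P -> (forall i, diag_pos_def (Q i)) ->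
  neg_def (Ric P Q) -> hurwitz M.
Proof.
move=> Pd Qd; have PT : P^T = P by rewrite (diag_pos_defE Pd) tr_diag_mx.
move=> Hneg; apply/(hurwitz_negative_on_col M_metzler).
have [//|[t [p [t0 p0 Mp]]]] := metzler_dichotomy M_metzler.
have := Hneg p p0; rewrite ltNge => /negP[].
have Pp : 0 <= (p^T *m P *m p) 0 0.
  rewrite (diag_pos_defE Pd) mul_mx_diag mxE; apply: sumr_ge0 => j _.
  rewrite !mxE mulrAC -expr2; apply: mulr_ge0; first exact: sqr_ge0.
  exact: ltW (Pd.2 j).
have scal_tr (X : 'M[R]_1) : X^T 0 0 = X 0 0 by rewrite mxE.
pose y i := (Ab i)^T *m P *m p.
have yE i : (p^T *m y i) 0 0 = (p^T *m P *m Ab i *m p) 0 0.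
  by rewrite -scal_tr /y !trmx_mul !trmxK PT !mulmxA.
have A0E : (p^T *m A0^T *m P *m p) 0 0 = (p^T *m P *m A0 *m p) 0 0.
  by rewrite -scal_tr !trmx_mul !trmxK PT !mulmxA.
have ypE i : (p^T *m P *m Ab i *m invmx (Q i) *m (Ab i)^T *m P *m p) 0 0
    = ((y i)^T *m invmx (Q i) *m y i) 0 0.
  by rewrite /y !trmx_mul !trmxK PT !mulmxA.
have -> : (p^T *m Ric P Q *m p) 0 0 = 2 * (p^T *m P *m A0 *m p) 0 0 +
    \sum_(i < N) ((p^T *m Q i *m p) 0 0 + ((y i)^T *m invmx (Q i) *m y i) 0 0).
  rewrite /Ric !mulmxDr !mulmxDl !mulmxA mulmx_sumr mulmx_suml 2!mxE A0E summxE.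
  congr (_ + _); first by ring.
  by apply: eq_bigr => i _; rewrite mulmxDr mulmxDl mxE -ypE !mulmxA.
apply: (@le_trans _ _ (2 * (t * (p^T *m P *m p) 0 0))).
  by rewrite !mulr_ge0.
have -> : t * (p^T *m P *m p) 0 0 = (p^T *m P *m A0 *m p) 0 0 +
    \sum_(i < N) (p^T *m y i) 0 0.
  under eq_bigr do rewrite yE.
  transitivity ((p^T *m P *m M *m p) 0 0).
    by rewrite -[in RHS]mulmxA Mp -scalemxAr [RHS]mxE.
  by rewrite /M mulmxDr mulmxDl mxE mulmx_sumr mulmx_suml summxE.
by rewrite mulrDr lerD2l mulr_sumr; apply: ler_sum => i _; exact: diag_young.
Qed.

(* With [M u < 0] and [v^T M < 0], take [P u = v] and [Q_i u] slightly above [Ab_i^T v]: then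
   [Ric P Q *m u] is at most [M^T v + P M u] up to a small error. *)
Lemma hurwitz_riccati : hurwitz M ->
  exists P Q, [/\ diag_pos_def P, forall i, diag_pos_def (Q i) & neg_def (Ric P Q)].
Proof.
move=> hM; have [v [v0 Mv]] := (hurwitz_negative_on M_metzler).1 hM.
have [u [u0 Mu]] := (hurwitz_negative_on_col M_metzler).1 hM.
pose P : 'M[R]_n := diag_mx (\row_j (v j 0 / u j 0)).
have Pd : diag_pos_def P by apply: diag_pos_def_diag => j; rewrite divr_gt0.
have Pu : P *m u = v.
  by rewrite mul_diag_mx; apply/colP => j; rewrite !mxE divfK// gt_eqF.
have P0 i j : 0 <= P i j by rewrite !mxE mulrn_wge0// divr_ge0// ltW.
have [|m m0 mle] := @finite_lower_bound R n (fun j => - (M^T *m v + P *m M *m u) j 0).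
  move=> j; rewrite mxE oppr_gt0 -[ltRHS]addr0 ltrD// -mulmxA mul_diag_mx !mxE.
  by rewrite pmulr_rlt0 ?divr_gt0//; have := Mu j; rewrite mxE.
(* Each [Q i] contributes one error [e]; the [+ 1] in the denominator makes the total [N e] strictly
   smaller than the margin [m], also when [N = 0]. *)
pose e := m / (N%:R + 1).
have N0 : 0 < N%:R + 1 :> R by rewrite ltr_wpDl.
have e0 : 0 < e by rewrite divr_gt0.
(* This gives [Q_i u = Ab_i^T v + e]: the [e] keeps [Q_i] positive where [Ab_i^T v] vanishes, and
   [Q_i^-1 Ab_i^T v <= u] bounds the quadratic term by [P Ab_i u]. *)
pose q i j := (((Ab i)^T *m v) j 0 + e) / u j 0.
have Av0 i j : 0 <= ((Ab i)^T *m v) j 0.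
  by apply: mulmx_ge0 => k l; rewrite ?mxE// ord1 ltW.
have q0 i j : 0 < q i j by rewrite divr_gt0// ltr_wpDl.
pose Q i : 'M[R]_n := diag_mx (\row_j q i j).
have Qd i : diag_pos_def (Q i) by exact: diag_pos_def_diag.
exists P, Q; split=> //.
have T0 i a b : 0 <= (Ab i)^T a b by rewrite mxE.
have Q0 i a b : 0 <= invmx (Q i) a b.
  by rewrite invmx_diag_pos// !mxE mulrn_wge0// invr_ge0 ltW.
apply: (metzler_sym_neg_def (u := u)); last split=> // j.
- move=> j k jk; rewrite mxE [X in 0 <= X + _]mxE summxE !addr_ge0 ?sumr_ge0//.
  + by rewrite mul_mx_diag !mxE mulr_ge0 ?divr_ge0 ?A0_metzler 1?eq_sym// ltW.
  + by rewrite mul_diag_mx !mxE mulr_ge0 ?divr_ge0 ?A0_metzler// ltW.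
  + move=> i _; rewrite mxE addr_ge0//; first by rewrite (Qd i).1.
    by do 4!(apply: mulmx_ge0 => //).
- exact: Ric_tr.
have -> : (Ric P Q *m u) j 0 = (A0^T *m v) j 0 + (P *m A0 *m u) j 0 +
    \sum_(i < N) (((Ab i)^T *m v) j 0 + e +
       (P *m Ab i *m (invmx (Q i) *m ((Ab i)^T *m v))) j 0).
  rewrite /Ric 2!mulmxDl -(mulmxA _ P) Pu mxE [X in X + _ = _]mxE; congr (_ + _).
  rewrite mulmx_suml summxE; apply: eq_bigr => i _.
  rewrite mulmxDl -(mulmxA _ P u) Pu mxE -!mulmxA; congr (_ + _).
  by rewrite mul_diag_mx mxE mxE /q divfK// gt_eqF.
have wu i k : (invmx (Q i) *m ((Ab i)^T *m v)) k 0 <= u k 0.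
  rewrite invmx_diag_pos// mul_diag_mx mxE mxE ler_pdivrMl//.
  by rewrite /q divfK ?gt_eqF// lerDl ltW.
apply: (@le_lt_trans _ _ ((M^T *m v + P *m M *m u) j 0 + N%:R * e)).
  have -> : (M^T *m v + P *m M *m u) j 0 + N%:R * e =
      (A0^T *m v) j 0 + (P *m A0 *m u) j 0 +
      \sum_(i < N) (((Ab i)^T *m v) j 0 + e + (P *m Ab i *m u) j 0).
    rewrite !big_split/= sumr_const card_ord -[e *+ N]mulr_natl.
    rewrite /M linearD/= linear_sum/= mulmxDr !mulmxDl mulmx_sumr !mulmx_suml.
    rewrite mxE [X in X + _ + _ = _]mxE [X in _ + X + _ = _]mxE !summxE; ring.
  rewrite lerD2l; apply: ler_sum => i _; rewrite lerD2l ![(P *m Ab i *m _) j 0]mxE.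
  by apply: ler_sum => k _; rewrite ler_wpM2l ?wu//; apply: mulmx_ge0.
have : N%:R * e < m.
  by rewrite /e mulrA ltr_pdivrMr// mulrC ltr_pM2l// ltrDl.
by have := mle j; lra.
Qed.

End DiagonalRiccati.

(** * Integrals against the delay kernels *)

(** A continuous function on a compact interval is measurable and bounded. *)
Lemma integrable_mul_continuous (R : realType) (a b : R) (f g : R -> R) :
  lebesgue_measure.-integrable `[a, b] (EFin \o f) -> {within `[a, b], continuous g} ->
  lebesgue_measure.-integrable `[a, b] (EFin \o (fun t => f t * g t)).
Proof.
move=> fi cg.
have -> : EFin \o (fun t => f t * g t) = ((EFin \o f) \* (EFin \o g))%E.
  by apply/funext => t /=; rewrite EFinM.
apply: integrableMl => //; first exact: subspace_continuous_measurable_fun.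
have /compact_bounded[M [Mr Mb]] := continuous_compact cg (segment_compact (a := a) (b := b)).
exists M; split=> // r Mr' x xab /=; apply: Mb Mr' _ _ .
by exists x.
Qed.

Lemma integrable_sumR (R : realType) (D : set R) (I : Type) (r : seq I) (f : I -> R -> R) :
  measurable D ->
  (forall i, lebesgue_measure.-integrable D (EFin \o f i)) ->
  lebesgue_measure.-integrable D (EFin \o (fun t => \sum_(i <- r) f i t)).
Proof.
move=> mD fi.
have -> : EFin \o (fun t => \sum_(i <- r) f i t) = (fun t => \sum_(i <- r) (EFin \o f i) t)%E.
  by apply/funext => t /=; rewrite sumEFin.
by apply: integrable_sum => // i _; exact: fi.
Qed.

Lemma Rintegral_sum (R : realType) (D : set R) (I : Type) (r : seq I) (f : I -> R -> R) :
  measurable D ->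
  (forall i, lebesgue_measure.-integrable D (EFin \o f i)) ->
  Rintegral lebesgue_measure D (fun t => \sum_(i <- r) f i t) =
  \sum_(i <- r) Rintegral lebesgue_measure D (f i).
Proof.
move=> mD fi; elim: r => [|i r IH].
  under eq_Rintegral do rewrite big_nil.
  by rewrite big_nil Rintegral_cst// mul0r.
under eq_Rintegral do rewrite big_cons.
by rewrite RintegralD ?IH ?big_cons//; exact: integrable_sumR.
Qed.

Section Kernel.
Variables (R : realType) (n : nat) (h : R) (A : R -> 'M[R]_n).
Hypothesis Ai : forall j k : 'I_n,
  lebesgue_measure.-integrable `[- h, 0] (EFin \o (fun t => A t j k)).
Hypothesis A0 : forall t, - h <= t <= 0 -> forall j k : 'I_n, 0 <= A t j k.

Let A0' t : `[- h, 0]%classic t -> forall j k : 'I_n, 0 <= A t j k.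
Proof. by rewrite /= in_itv/=; exact: A0. Qed.

Lemma kernel_int_ge0 j k : 0 <= kernel_int h A j k.
Proof. by rewrite mxE; apply: Rintegral_ge0 => t tD; exact: (A0' tD). Qed.

Lemma kernel_mulmx_integrable (y : R -> 'cV[R]_n) (j : 'I_n) :
  (forall k, {within `[- h, 0], continuous (fun t => y t k 0 : R)}) ->
  lebesgue_measure.-integrable `[- h, 0] (EFin \o (fun t => (A t *m y t) j 0)).
Proof.
move=> cy; have -> : (fun t => (A t *m y t) j 0) = (fun t => \sum_k A t j k * y t k 0).
  by apply/funext => t; rewrite mxE.
by apply: integrable_sumR => // k; exact: integrable_mul_continuous.
Qed.

Lemma kernel_mulmx_int (y : R -> 'cV[R]_n) (j : 'I_n) :
  (forall k, {within `[- h, 0], continuous (fun t => y t k 0 : R)}) ->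
  Rintegral lebesgue_measure `[- h, 0] (fun t => (A t *m y t) j 0) =
  \sum_k Rintegral lebesgue_measure `[- h, 0] (fun t => A t j k * y t k 0).
Proof.
move=> cy; under eq_Rintegral do rewrite mxE.
by rewrite Rintegral_sum// => k; exact: integrable_mul_continuous.
Qed.

(** A nonnegative kernel carries a pointwise bound on the history over to the delay term; this is
    the estimate used at the barrier. *)
Lemma kernel_mulmx_le (y : R -> 'cV[R]_n) (u : 'cV[R]_n) (j : 'I_n) :
  (forall k, {within `[- h, 0], continuous (fun t => y t k 0 : R)}) ->
  (forall k t, - h <= t <= 0 -> y t k 0 <= u k 0) ->
  Rintegral lebesgue_measure `[- h, 0] (fun t => (A t *m y t) j 0) <= (kernel_int h A *m u) j 0.
Proof.
move=> cy yu; rewrite kernel_mulmx_int// mxE; apply: ler_sum => k _.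
rewrite mxE -RintegralZr//; apply: le_Rintegral => //.
- exact: integrable_mul_continuous.
- by apply: integrable_mul_continuous => //; exact: cst_continuous.
- by move=> t tD; rewrite ler_wpM2l ?A0' ?yu//; move: tD; rewrite /= in_itv.
Qed.

Lemma continuous_expRM (t : R) : continuous (fun s : R => expR (t * s)).
Proof.
by move=> s; apply: (@continuous_comp _ _ _ (fun s => t * s) expR);
  [exact: mulrl_continuous|exact: continuous_expR].
Qed.

(** The Laplace-type transform by which the kernel enters the characteristic matrix of the delay
    system. *)
Definition kernel_exp (t : R) : 'M[R]_n := kernel_int h (fun s => expR (t * s) *: A s).

Let kernel_expE t j k : kernel_exp t j k =
  Rintegral lebesgue_measure `[- h, 0] (fun s => A s j k * expR (t * s)).
Proof. by rewrite mxE; apply: eq_Rintegral => s _; rewrite mxE mulrC. Qed.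

Let kernel_exp_integrable t (j k : 'I_n) :
  lebesgue_measure.-integrable `[- h, 0] (EFin \o (fun s => A s j k * expR (t * s))).
Proof.
apply: integrable_mul_continuous => //; apply: continuous_subspaceT; exact: continuous_expRM.
Qed.

Lemma kernel_exp_ge0 t j k : 0 <= kernel_exp t j k.
Proof.
by rewrite kernel_expE; apply: Rintegral_ge0 => s sD; rewrite mulr_ge0 ?expR_ge0 ?A0'.
Qed.

Lemma kernel_exp0 : kernel_exp 0 = kernel_int h A.
Proof.
apply/matrixP => j k; rewrite kernel_expE mxE; apply: eq_Rintegral => s _.
by rewrite mul0r expR0 mulr1.
Qed.

(** The window consists of nonpositive times [r], where [exp(t r)] decreases in [t]. *)
Lemma kernel_exp_le s t j k : s <= t -> kernel_exp t j k <= kernel_exp s j k.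
Proof.
move=> st; rewrite !kernel_expE; apply: le_Rintegral => // r rD.
rewrite ler_wpM2l ?A0'// ler_expR; move: rD; rewrite /= in_itv/= => /andP[_ r0].
by rewrite ler_wnM2r.
Qed.

Lemma continuous_expRZ (t : R) (p : 'cV[R]_n) (k : 'I_n) :
  continuous (fun s : R => (expR (t * s) *: p) k 0 : R).
Proof.
have -> : (fun s => (expR (t * s) *: p) k 0) = (fun s => expR (t * s)) \* cst (p k 0).
  by apply/funext => s; rewrite mxE.
by move=> s; apply: continuousM; [exact: continuous_expRM|exact: cst_continuous].
Qed.

Lemma kernel_exp_mulmx t (p : 'cV[R]_n) (j : 'I_n) :
  Rintegral lebesgue_measure `[- h, 0] (fun s => (A s *m (expR (t * s) *: p)) j 0) =
  (kernel_exp t *m p) j 0.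
Proof.
rewrite kernel_mulmx_int => [|k]; last by apply: continuous_subspaceT; exact: continuous_expRZ.
rewrite mxE; apply: eq_bigr => k _; rewrite kernel_expE -RintegralZr//.
by apply: eq_Rintegral => s _; rewrite mxE mulrA.
Qed.

(** For [a <= b], factor out [exp b <= 1] and use [1 + (a - b) <= exp(a - b)]. *)
Lemma expR_lipschitz_npos (a b : R) : a <= 0 -> b <= 0 -> `|expR a - expR b| <= `|a - b|.
Proof.
wlog ab : a b / a <= b => [H a0 b0|_ b0].
  have [|/ltW] := leP a b => ab; first exact: H.
  by rewrite distrC [leRHS]distrC; apply: H.
rewrite ler0_norm ?subr_le0 ?ler_expR// [leRHS]ler0_norm ?subr_le0// !opprB.
have -> : expR b - expR a = expR b * (1 - expR (a - b)).
  by rewrite mulrBr mulr1 -expRD addrCA subrr addr0.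
have : 1 + (a - b) <= expR (a - b) by exact: expR_ge1Dx.
have : expR b <= 1 by rewrite -expR0 ler_expR.
have := expR_gt0 b; have : expR (a - b) <= 1 by rewrite -expR0 ler_expR subr_le0.
by nra.
Qed.

(** For [s] and [t] nonnegative the exponents on the window are nonpositive and differ by at most
    [h |s - t|], so the Lipschitz bound for [expR] integrates against [A]. *)
Lemma kernel_exp_lip s t j k : 0 <= s -> 0 <= t ->
  `|kernel_exp s j k - kernel_exp t j k| <= h * kernel_int h A j k * `|s - t|.
Proof.
move=> s0 t0; rewrite !kernel_expE -RintegralB//.
have iB : lebesgue_measure.-integrable `[- h, 0]
    (EFin \o (fun r => A r j k * expR (s * r) - A r j k * expR (t * r))).
  have -> : EFin \o (fun r => A r j k * expR (s * r) - A r j k * expR (t * r)) =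
      ((EFin \o (fun r => A r j k * expR (s * r))%R) \-
       (EFin \o (fun r => A r j k * expR (t * r))%R))%E.
    by apply/funext => r /=; rewrite EFinB.
  exact: integrableB.
rewrite (le_trans (le_normr_Rintegral _ iB))//.
rewrite mulrAC mxE -RintegralZl//; apply: le_Rintegral => //.
- exact: integrable_norm iB.
- have -> : (fun r => h * `|s - t| * A r j k) = (fun r => A r j k * (h * `|s - t|)).
    by apply/funext => r; rewrite mulrC.
  by apply: integrable_mul_continuous => //; exact: cst_continuous.
move=> r rD; rewrite -mulrBr normrM ger0_norm ?A0'// mulrC ler_wpM2r ?A0'//.
move: rD; rewrite /= in_itv/= => /andP[hr r0].
rewrite (le_trans (expR_lipschitz_npos _ _)) ?mulr_ge0_le0//.
by rewrite -mulrBl normrM mulrC ler_wpM2r// ler0_norm// lerNl.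
Qed.

End Kernel.

(** * Exponential solutions *)

Lemma vnorm_ge (R : realType) (n : nat) (x : 'cV[R]_n) (j : 'I_n) : `|x j 0| <= vnorm x.
Proof. exact: (le_bigmax_cond _ (fun j => `|x j 0|)). Qed.

Lemma vnorm_lt (R : realType) (n : nat) (x : 'cV[R]_n) (e : R) :
  0 < e -> (forall j, `|x j 0| < e) -> vnorm x < e.
Proof. by move=> e0 xe; apply: bigmax_lt. Qed.

Lemma hmax_ge (R : realType) (N : nat) (hb : 'I_N -> R) (i : 'I_N) : hb i <= hmax hb.
Proof. exact: le_bigmax_cond. Qed.

Lemma hmax_ge0 (R : realType) (N : nat) (hb : 'I_N -> R) : 0 <= hmax hb.
Proof. exact: bigmax_ge_id. Qed.

Section Delay.
Variables (R : realType) (n N : nat) (A0 : 'M[R]_n) (hb : 'I_N -> R) (A : 'I_N -> R -> 'M[R]_n).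
Hypothesis A0_metzler : metzler A0.
Hypothesis hb_gt0 : forall i, 0 < hb i.
Hypothesis A_int : forall i (j k : 'I_n),
  lebesgue_measure.-integrable `[- hb i, 0] (EFin \o (fun t => A i t j k)).
Hypothesis A_ge0 : forall i t, - hb i <= t <= 0 -> forall j k : 'I_n, 0 <= A i t j k.

Let S := \sum_(i < N) kernel_int (hb i) (A i).

Lemma kernel_sum_ge0 j k : 0 <= S j k.
Proof.
by rewrite summxE; apply: sumr_ge0 => i _; apply: kernel_int_ge0; exact: A_ge0.
Qed.

Lemma delay_metzler : metzler (A0 + S).
Proof. exact: metzlerD kernel_sum_ge0. Qed.

Let F t := A0 + \sum_(i < N) kernel_exp (hb i) (A i) t.

(** The factor [exp(t s)] comes out of every delay integral, which reduces the equation to the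
    characteristic equation [F t p = t p]. *)
Lemma exponential_solution (t : R) (p : 'cV[R]_n) :
  F t *m p = t *: p -> dd_solution A0 hb A (fun s => expR (t * s) *: p).
Proof.
move=> Fp; split=> [k|s s0 k].
  by apply: continuous_subspaceT; exact: continuous_expRZ.
have [ds es] : is_derive s (1 : R) (fun s : R => (expR (t * s) *: p) k 0 : R)
    (t * expR (t * s) * p k 0).
  have -> : (fun s => (expR (t * s) *: p) k 0) = (expR \o (fun s => t * s)) \* cst (p k 0).
    by apply/funext => r; rewrite mxE.
  apply: is_derive_eq; rewrite /= /GRing.scale/=. ring.
split=> //; rewrite derive1E es /dd_rhs mxE.
have -> : t * expR (t * s) * p k 0 = expR (t * s) * (F t *m p) k 0.
  by rewrite Fp mxE; ring.
rewrite /F mulmxDl mulmx_suml [in LHS]mxE mulrDr -scalemxAr [X in _ = X + _]mxE.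
congr (_ + _).
rewrite !summxE mulr_sumr; apply: eq_bigr => i _; rewrite [RHS]mxE -kernel_exp_mulmx//.
rewrite -RintegralZl//; last first.
  apply: kernel_mulmx_integrable => // l.
  by apply: continuous_subspaceT; exact: continuous_expRZ.
by apply: eq_Rintegral => r _; rewrite mulrDr expRD -scalerA -[in RHS]scalemxAr [RHS]mxE.
Qed.

(** [F] meets the hypotheses of the family dichotomy, and attractivity excludes its second
    alternative: an exponential solution with [t >= 0] does not tend to zero. *)
Lemma asym_stable_hurwitz : dd_asym_stable A0 hb A -> hurwitz (A0 + S).
Proof.
move=> [_ attr]; apply/(hurwitz_negative_on_col delay_metzler).
pose K i j k := kernel_int (hb i) (A i) j k.
pose L := \sum_(i < N) \sum_j \sum_k hb i * K i j k.
have hK0 i j k : 0 <= hb i * K i j k.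
  by rewrite mulr_ge0 ?(ltW (hb_gt0 i))//; apply: kernel_int_ge0; exact: A_ge0.
have Fm t : 0 <= t -> metzler (F t).
  move=> t0; apply: metzlerD => // j k; rewrite summxE; apply: sumr_ge0 => i _.
  by apply: kernel_exp_ge0; exact: A_ge0.
have Fle s t j k : 0 <= s -> s <= t -> F t j k <= F s j k.
  move=> _ st; rewrite !mxE lerD2l !summxE; apply: ler_sum => i _.
  by apply: kernel_exp_le => //; exact: A_ge0.
have Flip s t j k : 0 <= s -> 0 <= t -> `|F s j k - F t j k| <= L * `|s - t|.
  move=> s0 t0; rewrite /F !mxE opprD addrACA subrr add0r !summxE -sumrB.
  rewrite (le_trans (ler_norm_sum _ _ _))// /L mulr_suml; apply: ler_sum => i _.
  apply: (le_trans (kernel_exp_lip (A_int i) (@A_ge0 i) j k s0 t0)).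
  rewrite ler_wpM2r// [leRHS](bigD1 j)//= [X in _ <= X + _](bigD1 k)//= -addrA lerDl.
  by rewrite addr_ge0 ?sumr_ge0// => l _; apply: sumr_ge0.
have [[u]|] := metzler_family_dichotomy Fm Fle Flip.
  by rewrite /F; under eq_bigr do rewrite kernel_exp0; exists u.
move=> [t [p [t0 /cV0Pn[j pj] Fp]]].
have e0 : 0 < `|p j 0| by rewrite normr_gt0.
(* At a nonnegative time beyond [T] the exponential is at least 1, so coordinate [j] has not dropped
   below its value [|p j|] at time 0. *)
have [T /(_ (Num.max T 0))] := attr _ (exponential_solution Fp) _ e0.
rewrite le_max lexx => /(_ isT) /(le_lt_trans (vnorm_ge _ j)).
rewrite mxE normrM ger0_norm ?expR_ge0// ltNge ler_peMl// -expR0 ler_expR.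
by rewrite mulr_ge0// le_max lexx orbT.
Qed.

End Delay.

(** * Decay of solutions *)

Lemma within_near_ball (R : realType) (D : set R) (f : R -> R) (t c : R) :
  {within D, continuous f} -> D t ->
  (f t < c -> exists2 d, 0 < d & forall s, D s -> `|t - s| < d -> f s < c) /\
  (c < f t -> exists2 d, 0 < d & forall s, D s -> `|t - s| < d -> c < f s).
Proof.
move=> /subspace_continuousP/(_ t) cf /cf ct; split=> ftc.
  have : \forall s \near within D (nbhs t), f s < c by exact: cvgr_lt ct _ ftc.
  by rewrite near_withinE => /nbhs_ballP[d /= d0 Bd]; exists d => // s Ds ts; apply: Bd.
have : \forall s \near within D (nbhs t), c < f s by exact: cvgr_gt ct _ ftc.
by rewrite near_withinE => /nbhs_ballP[d /= d0 Bd]; exists d => // s Ds ts; apply: Bd.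
Qed.

Lemma derive1_lt0_left (R : realType) (f : R -> R) (t : R) :
  derivable f t 1 -> f^`() t < 0 ->
  exists2 d, 0 < d & forall h, 0 < h -> h < d -> f t < f (t - h).
Proof.
move=> df; rewrite derive1E => ft0.
have : \forall h \near (0 : R)^', h^-1 *: (f (h *: 1 + t) - f t) < 0.
  exact: cvgr_lt df _ ft0.
rewrite near_withinE => /nbhs_ballP[d /= d0 Bd].
exists d => // h h0 hd; have := Bd (- h); rewrite /ball/= sub0r opprK gtr0_norm// => /(_ hd).
rewrite oppr_eq0 gt_eqF// => /(_ isT).
rewrite /GRing.scale/= mulr1 invrN mulNr oppr_lt0 pmulr_rgt0 ?invr_gt0// subr_gt0.
by rewrite addrC.
Qed.

(** First-touch argument. At the infimum [t0] of the times when some component is nonnegative,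
    continuity makes all components nonpositive and one of them zero. Its negative derivative makes
    it positive just before [t0], a contradiction. *)
Lemma barrier (R : realType) (I : finType) (f : I -> R -> R) :
  (forall k, {within [set s | 0 <= s], continuous (f k)}) ->
  (forall k t, 0 < t -> derivable (f k) t 1) ->
  (forall k, f k 0 < 0) ->
  (forall k t, 0 < t -> (forall l s, 0 <= s <= t -> f l s <= 0) -> f k t = 0 -> (f k)^`() t < 0) ->
  forall k t, 0 <= t -> f k t < 0.
Proof.
move=> cf df f0 f' k1 t1 t10; rewrite ltNge; apply/negP => f1.
pose E := [set t | 0 <= t /\ exists k, 0 <= f k t].
have hE : has_inf E.
  by split; [exists t1; split=> //; exists k1 | exists 0 => t []].
set t0 := inf E.
have t00 : 0 <= t0 by apply: lb_le_inf hE.1 _ => t [].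
have before k s : 0 <= s -> s < t0 -> f k s < 0.
  move=> s0 st; rewrite ltNge; apply/negP => fs.
  have /(ge_inf hE.2) : E s by split=> //; exists k.
  by rewrite leNgt st.
have [k fk0] : exists k, 0 <= f k t0.
  apply: contrapT => /forallNP fN.
  have fneg k : f k t0 < 0 by rewrite ltNge; apply/negP/fN.
  (* If all components were negative at [t0], the least of finitely many radii would keep them
     negative slightly beyond it, where [E] has points. *)
  have /choice[d dP] k : exists d, 0 < d /\ forall s, 0 <= s -> `|t0 - s| < d -> f k s < 0.
    by have [d d0 dP] := (within_near_ball 0 (cf k) t00).1 (fneg k); exists d.
  pose m := \big[Num.min/1]_k d k.
  have m0 : 0 < m by apply: lt_bigmin => // k _; exact: (dP k).1.
  have [s Es st] := inf_adherent m0 hE.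
  have t0s : t0 <= s by apply: ge_inf Es; exact: hE.2.
  have [s0 [k fks]] := Es.
  suff /((dP k).2 s s0) : `|t0 - s| < d k by rewrite ltNge fks.
  rewrite ler0_norm ?subr_le0// opprB ltrBlDl (lt_le_trans st)// lerD2l.
  exact: bigmin_le_cond.
have t0p : 0 < t0.
  by rewrite lt_def t00 andbT; apply/eqP => t0E; have := fk0; rewrite t0E leNgt f0.
have le0 l : f l t0 <= 0.
  rewrite leNgt; apply/negP => fl.
  have [d d0 dP] := (within_near_ball 0 (cf l) t00).2 fl.
  pose s := Num.max 0 (t0 - d / 2).
  have s0 : 0 <= s by rewrite le_max lexx.
  have st : s < t0 by rewrite gt_max t0p ltrBlDr ltrDl divr_gt0.
  have : 0 < f l s.
    apply: dP => //; rewrite ger0_norm ?subr_ge0 ?(ltW st)//.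
    have : t0 - d / 2 <= s by rewrite le_max lexx orbT.
    by lra.
  by rewrite ltNge (ltW (before l s s0 st)).
have fk : f k t0 = 0 by apply/eqP; rewrite eq_le le0 fk0.
have [|d d0 dP] := derive1_lt0_left (df k t0 t0p) (f' k t0 t0p _ fk).
  move=> l s /andP[s0]; rewrite le_eqVlt => /predU1P[->//|st].
  exact/ltW/before.
(* The cap at [t0] keeps [t0 - h] in the nonnegative times covered by [before]. *)
pose h := Num.min (d / 2) t0.
have h0 : 0 < h by rewrite lt_min divr_gt0.
have hd : h < d by rewrite gt_min ltr_pdivrMr// ltr_pMr// ltr1n.
have := dP h h0 hd; rewrite fk ltNge ltW// before//.
  by rewrite subr_ge0 ge_min lexx orbT.
by rewrite ltrBlDl ltrDr.
Qed.

Lemma continuous_shift_within (R : realType) (D D' : set R) (f : R -> R) (t : R) :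
  {within D, continuous f} -> (forall s, D' s -> D (t + s)) ->
  {within D', continuous (fun s => f (t + s))}.
Proof.
move=> /subspace_continuousP cf DD; apply/subspace_continuousP => s Ds U /= HU.
have ct : continuous (fun s : R => t + s).
  by move=> r; apply: cvgD; [exact: cvg_cst|exact: cvg_id].
have fU := ct s _ (cf _ (DD _ Ds) _ HU).
suff : \forall r \near s, D' r -> U (f (t + r)) by [].
by near=> r => D'r; have := DD r D'r; near: r.
Unshelve. all: by end_near.
Qed.

(** At [g = 0] the expression is [a + b < 0]; continuity and finiteness of the index set leave room
    for [g > 0]. It is applied with [a = A0 u] and [b = S u], the factor [exp(g H)] being the growth
    of the envelope back over the longest delay. *)
Lemma exists_decay_rate (R : realType) (n : nat) (a b u : 'cV[R]_n) (H : R) :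
  (forall j, a j 0 + b j 0 < 0) ->
  exists2 g, 0 < g & forall j, a j 0 + expR (g * H) * b j 0 + g * u j 0 < 0.
Proof.
move=> ab.
have ct j : (fun g : R => a j 0 + expR (g * H) * b j 0 + g * u j 0) @ (0 : R) -->
    a j 0 + expR (0 * H) * b j 0 + 0 * u j 0.
  apply: cvgD; last by apply: cvgM; [exact: cvg_id|exact: cvg_cst].
  apply: cvgD; first exact: cvg_cst.
  apply: cvgM; last exact: cvg_cst.
  have -> : (fun g => expR (g * H)) = (fun g => expR (H * g)).
    by apply/funext => g; rewrite mulrC.
  by rewrite mulrC; exact: continuous_expRM.
have : \forall g \near (0 : R), forall j, a j 0 + expR (g * H) * b j 0 + g * u j 0 < 0.
  have neg j : \forall g \near (0 : R), a j 0 + expR (g * H) * b j 0 + g * u j 0 < 0.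
    by apply: (cvgr_lt _ (ct j)); rewrite !mul0r expR0 mul1r addr0.
  exact: filter_forall neg.
move=> /nbhs_ballP[d /= d0 Bd]; exists (d / 2); first by rewrite divr_gt0.
by apply: Bd; rewrite /ball/= sub0r normrN gtr0_norm ?divr_gt0// ltr_pdivrMr// ltr_pMr// ltr1n.
Qed.

(** * Exponential envelopes and asymptotic stability *)

Section DelayStability.
Variables (R : realType) (n N : nat) (A0 : 'M[R]_n) (hb : 'I_N -> R) (A : 'I_N -> R -> 'M[R]_n).
Hypothesis A0_metzler : metzler A0.
Hypothesis A_int : forall i (j k : 'I_n),
  lebesgue_measure.-integrable `[- hb i, 0] (EFin \o (fun t => A i t j k)).
Hypothesis A_ge0 : forall i t, - hb i <= t <= 0 -> forall j k : 'I_n, 0 <= A i t j k.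

Let S := \sum_(i < N) kernel_int (hb i) (A i).

Lemma dd_solution_history (x : R -> 'cV[R]_n) (t : R) (i : 'I_N) (k : 'I_n) :
  dd_solution A0 hb A x -> 0 <= t ->
  {within `[- hb i, 0], continuous (fun s => x (t + s) k 0 : R)}.
Proof.
move=> [cx _] t0; apply: continuous_shift_within (cx k) _ => s /=.
by rewrite in_itv/= => /andP[hs _]; have := hmax_ge hb i; lra.
Qed.

(** This turns the one-sided upper estimate into a bound on absolute values. *)
Lemma dd_solution_opp (x : R -> 'cV[R]_n) :
  dd_solution A0 hb A x -> dd_solution A0 hb A (fun s => - x s).
Proof.
move=> solx; have [cx dx] := solx.
have xN j : (fun s => (- x s) j 0) = \- (fun s => x s j 0).
  by apply/funext => s; rewrite mxE.
split=> [j|t t0 j]; first by rewrite xN => s; apply: continuousN; exact: cx.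
have [d1 d2] := dx t t0 j; rewrite xN; split; first exact: derivableN.
rewrite derive1E deriveN// -derive1E d2 /dd_rhs mulmxN !mxE opprD; congr (_ + _).
rewrite !summxE -sumrN; apply: eq_bigr => i _; rewrite !mxE.
rewrite -mulN1r -RintegralZl//; last first.
  by apply: kernel_mulmx_integrable => // k; apply: dd_solution_history => //; exact: ltW.
by apply: eq_Rintegral => s _; rewrite mulmxN [RHS]mxE mulN1r.
Qed.

(** The barrier lemma is applied to [x - c u exp(- g t)]. At a touching point the derivative is at
    most [c exp(- g t)] times the left side of the inequality that defines [g], hence negative. *)
Lemma delay_upper_estimate (x : R -> 'cV[R]_n) (u : 'cV[R]_n) (g c : R) :
  (forall j, 0 < u j 0) -> 0 < g -> 0 < c ->
  (forall j, (A0 *m u) j 0 + expR (g * hmax hb) * (S *m u) j 0 + g * u j 0 < 0) ->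
  dd_solution A0 hb A x -> (forall j s, - hmax hb <= s <= 0 -> x s j 0 < c * u j 0) ->
  forall j t, 0 <= t -> x t j 0 < c * u j 0 * expR (- g * t).
Proof.
move=> u0 g0 c0 gu solx x0; have [cx dx] := solx.
pose E t := expR (- g * t).
pose f (j : 'I_n) := (fun t => x t j 0) \- cst (c * u j 0) \* (expR \o (fun t => - g * t)).
have H0 := hmax_ge0 hb.
have df (j : 'I_n) (t : R) : 0 < t -> is_derive t (1 : R) (f j)
    (dd_rhs A0 hb A x t j 0 + g * (c * u j 0 * E t)).
  move=> t0; have [d1 <-] := dx t t0 j; rewrite derive1E.
  have dP := derivableP d1.
  by apply: is_derive_eq; rewrite /= /GRing.scale/= /E; ring.
suff fneg : forall j t, 0 <= t -> f j t < 0.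
  by move=> j t /(fneg j); rewrite /f /= subr_lt0.
apply: (barrier (f := f)) => [j|j t t0|j|j t t0 fle0 fj].
- have cxj : {within [set s | 0 <= s], continuous (fun s => x s j 0 : R)}.
    by apply: continuous_subspaceW (cx j) => s /=; lra.
  move=> t; apply: continuousB; first exact: cxj.
  apply: continuousM; first exact: cst_continuous.
  by apply: continuous_subspaceT => s; exact: continuous_expRM.
- by have [] := df j t t0.
- by rewrite /f /= mulr0 expR0 mulr1 subr_lt0 x0// lexx oppr_le0 H0.
have [_ ed] := df j t t0; rewrite derive1E ed.
have E0 : 0 < E t by exact: expR_gt0.
(* For [s < 0] the initial bound suffices, because the envelope factor [E s] is then at least 1. *)
have xle k s : - hmax hb <= s <= t -> x s k 0 <= c * u k 0 * E s.
  move=> /andP[hs st]; have [s0|s0] := leP 0 s.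
    by have := fle0 k s; rewrite s0 st /f /= subr_le0 => ->.
  rewrite (le_trans (ltW (x0 k s _))) ?hs ?(ltW s0)//.
  rewrite ler_peMr ?mulr_ge0 ?(ltW c0) ?(ltW (u0 k))// -expR0 ler_expR.
  by rewrite mulNr oppr_ge0 mulr_ge0_le0 ?(ltW g0)// ltW.
(* [c E(t) u - x(t)] is nonnegative and vanishes at [j], so row [j] of the Metzler matrix is
   nonnegative on it. *)
have A0x : (A0 *m x t) j 0 <= c * E t * (A0 *m u) j 0.
  have : 0 <= (A0 *m (c * E t *: u - x t)) j 0.
    apply: metzler_row_ge0 => // [k|].
      by rewrite !mxE subr_ge0 mulrAC xle// lexx andbT; lra.
    move: fj; rewrite /f /= !mxE /E; lra.
  by rewrite mulmxBr -scalemxAr mxE [X in X + _]mxE [X in _ + X]mxE subr_ge0.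
(* Going back by at most [hmax hb] increases the envelope by a factor of at most
   [expR (g * hmax hb)]. *)
have Ax i : Rintegral lebesgue_measure `[- hb i, 0] (fun s => (A i s *m x (t + s)) j 0) <=
    c * E t * expR (g * hmax hb) * (kernel_int (hb i) (A i) *m u) j 0.
  have -> : c * E t * expR (g * hmax hb) * (kernel_int (hb i) (A i) *m u) j 0 =
      (kernel_int (hb i) (A i) *m (c * E t * expR (g * hmax hb) *: u)) j 0.
    by rewrite -scalemxAr [RHS]mxE.
  apply: (kernel_mulmx_le (A_int i) (@A_ge0 i)) => [k|k s /andP[hs s0]].
    by apply: dd_solution_history => //; exact: ltW.
  have hbi := hmax_ge hb i.
  rewrite (le_trans (xle _ _ _))//; first by apply/andP; split; lra.
  rewrite mxE [leRHS](_ : _ = c * u k 0 * (E t * expR (g * hmax hb))); last by ring.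
  rewrite ler_wpM2l ?mulr_ge0 ?(ltW c0) ?(ltW (u0 k))// /E -expRD ler_expR mulrDr lerD2l.
  by rewrite mulNr -mulrN ler_wpM2l ?(ltW g0)//; lra.
have -> : dd_rhs A0 hb A x t j 0 = (A0 *m x t) j 0 + \sum_(i < N)
    Rintegral lebesgue_measure `[- hb i, 0] (fun s => (A i s *m x (t + s)) j 0).
  by rewrite /dd_rhs mxE summxE; congr (_ + _); apply: eq_bigr => i _; rewrite mxE.
apply: (@le_lt_trans _ _ (c * E t *
    ((A0 *m u) j 0 + expR (g * hmax hb) * (S *m u) j 0 + g * u j 0))); last first.
  by rewrite pmulr_rlt0// mulr_gt0.
rewrite !mulrDr; apply: lerD; last by rewrite le_eqVlt; apply/orP; left; apply/eqP; ring.
apply: lerD => //; rewrite mulrA /S mulmx_suml summxE mulr_sumr.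
by apply: ler_sum => i _; exact: Ax.
Qed.

(** Both halves of stability come from the decay estimate: [c] is proportional to [e] for stability,
    and fitted to the given initial function for attractivity. *)
Lemma hurwitz_asym_stable : hurwitz (A0 + S) -> dd_asym_stable A0 hb A.
Proof.
move=> /(hurwitz_negative_on_col (delay_metzler A0_metzler A_ge0))[u [u0 Mu]].
have [|g g0 gu] := @exists_decay_rate R n (A0 *m u) (S *m u) u (hmax hb).
  by move=> j; have := Mu j; rewrite mulmxDl mxE.
have H0 := hmax_ge0 hb.
have decay x c : dd_solution A0 hb A x -> 0 < c ->
    (forall j s, - hmax hb <= s <= 0 -> `|x s j 0| < c * u j 0) ->
    forall j t, 0 <= t -> `|x t j 0| < c * u j 0 * expR (- g * t).
  move=> solx c0 xc j t t0; rewrite ltr_norml ltrNl; apply/andP; split.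
    have := delay_upper_estimate u0 g0 c0 gu (dd_solution_opp solx) _ j t0.
    rewrite mxE; apply => k s hs; rewrite mxE.
    by have := xc k s hs; rewrite ltr_norml ltrNl => /andP[].
  apply: (delay_upper_estimate u0 g0 c0 gu solx) => // k s hs.
  by have := xc k s hs; rewrite ltr_norml => /andP[].
(* [m] and [K] bound the entries of [u] from below and above, converting between the weighted bounds
   and [vnorm]. *)
have [m m0 mu] := finite_lower_bound u0.
pose K := 1 + \sum_j `|u j 0|.
have K0 : 0 < K by rewrite ltr_pwDl// sumr_ge0.
have uK j : u j 0 <= K by apply: (le_trans (ler_sum_norm (fun j => u j 0) j)); rewrite /K lerDr.
split=> [e e0|x solx e e0].
  have c0 : 0 < e / K by rewrite divr_gt0.
  exists (e / K * m) => [|x solx xd t t0]; first by rewrite mulr_gt0.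
  apply: vnorm_lt => // j; apply: (@lt_le_trans _ _ (e / K * u j 0 * expR (- g * t))).
    apply: decay => // k s hs; rewrite (le_lt_trans (vnorm_ge _ k))//.
    by rewrite (lt_le_trans (xd s hs))// ler_wpM2l// ltW.
  apply: (@le_trans _ _ (e / K * K * 1)); last by rewrite mulr1 divfK// gt_eqF.
  apply: ler_pM; [|exact: expR_ge0| |].
  - by apply: mulr_ge0; exact: ltW.
  - by apply: ler_wpM2l => //; exact: ltW.
  - by rewrite -expR0 ler_expR mulNr oppr_le0 mulr_ge0// ltW.
have [cx _] := solx.
have /choice[b bP] j : exists b, forall s, - hmax hb <= s <= 0 -> `|x s j 0| <= b.
  have cxj : {within `[- hmax hb, 0], continuous (fun s => x s j 0 : R)}.
    by apply: continuous_subspaceW (cx j) => s /=; rewrite in_itv/= => /andP[].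
  have /compact_bounded[M [Mr Mb]] := continuous_compact cxj (segment_compact (a := _) (b := _)).
  exists (M + 1) => s hs; apply: (Mb (M + 1)); first by rewrite ltrDl.
  by exists s => //=; rewrite in_itv.
(* Chosen so that [c * m] strictly exceeds every bound [b j] on the initial function. *)
pose c := (1 + \sum_j `|b j|) / m.
have c0 : 0 < c by rewrite divr_gt0// ltr_pwDl// sumr_ge0.
have xc j s : - hmax hb <= s <= 0 -> `|x s j 0| < c * u j 0.
  move=> hs; rewrite (le_lt_trans (bP j s hs))//.
  apply: (@lt_le_trans _ _ (c * m)); last by rewrite ler_wpM2l// ltW.
  rewrite /c divfK ?gt_eqF//; have := ler_sum_norm b j; lra.
(* From this time on [c K <= e g t <= e exp(g t)], so the envelope is at most [e]. *)
exists (c * K / (e * g)) => t tT.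
have T0 : 0 <= c * K / (e * g) by apply: divr_ge0; apply: mulr_ge0; exact: ltW.
have t0 : 0 <= t by exact: le_trans tT.
apply: vnorm_lt => // j; apply: (lt_le_trans (decay x c solx c0 xc j t t0)).
rewrite mulNr expRN ler_pdivrMr ?expR_gt0//.
apply: (@le_trans _ _ (c * K)); first by rewrite ler_wpM2l// ltW.
apply: (@le_trans _ _ (e * (g * t))).
  by move: tT; rewrite ler_pdivrMr ?mulr_gt0//; lra.
by rewrite ler_wpM2l ?(ltW e0)//; have := expR_ge1Dx (g * t); lra.
Qed.

End DelayStability.

(** * The equivalences, each against Hurwitz stability of [A0 + S] *)

Unset Implicit Arguments.
Set Strict Implicit.

Theorem theorem18 (R : realType) (n N : nat) (A0 : 'M[R]_n)
  (hb : 'I_N -> R) (A : 'I_N -> R -> 'M[R]_n) :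
  metzler A0 ->
  (forall i, 0 < hb i) ->
  (forall i (j k : 'I_n),
     lebesgue_measure.-integrable `[- hb i, 0] (EFin \o (fun t => A i t j k))) ->
  (forall i t, - hb i <= t <= 0 -> forall j k : 'I_n, 0 <= A i t j k) ->
  let Abar := fun i => kernel_int (hb i) (A i) in
  let S := \sum_(i < N) Abar i in
  [/\ (dd_asym_stable A0 hb A <-> hurwitz (A0 + S)),
      (hurwitz (A0 + S) <->
         exists v : 'cV[R]_n, (forall j, 0 < v j 0) /\
           (forall j, (v^T *m (A0 + S)) 0 j < 0)),
      (hurwitz (A0 + S) <-> hurwitz A0 /\ schur (- (S *m invmx A0))) &
      (hurwitz (A0 + S) <->
         exists (P : 'M[R]_n) (Q : 'I_N -> 'M[R]_n),
           [/\ diag_pos_def P, (forall i, diag_pos_def (Q i)) &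
               neg_def (A0^T *m P + P *m A0 +
                 \sum_(i < N) (Q i + P *m Abar i *m invmx (Q i) *m (Abar i)^T *m P))])].
Proof.
move=> A0_metzler hb_gt0 A_int A_ge0 Abar S.
have Abar_ge0 i j k : 0 <= Abar i j k by apply: kernel_int_ge0; exact: A_ge0.
have S_ge0 j k : 0 <= S j k by exact: kernel_sum_ge0.
have MM : metzler (A0 + S) by exact: metzlerD.
split.
- by split; [exact: asym_stable_hurwitz|exact: hurwitz_asym_stable].
- apply: iff_trans (hurwitz_negative_on MM) _.
  (* Transposition identifies the row inequality with [negative_on] for the transposed matrix. *)
  have E (v : 'cV[R]_n) j : ((A0 + S)^T *m v) j 0 = (v^T *m (A0 + S)) 0 j.
    by rewrite -[v in LHS]trmxK -trmx_mul mxE.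
  by split=> -[v [v0 Mv]]; exists v; split=> // j; [rewrite -E|rewrite E].
- exact: hurwitz_schur_splitting.
- split=> [|[P [Q [Pd Qd Hneg]]]]; first exact: hurwitz_riccati.
  exact: riccati_hurwitz Pd Qd Hneg.
Qed.
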